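(* Let $g$ be a positive integer. If $E\subset M(\mathbb{C})^g$ is closed with respect to direct sums and is compact in the free topology, then there exists a nonzero free polynomial $p$ such that $p(Y)=0$ for all $Y\in E$. In particular, there is a positive integer $N$ such that for all $n\ge N$ the set $E(n)$ has empty interior in $M_n(\mathbb{C})^g$.
   Context: For positive integers $n,g$, $M_n(\mathbb{C})^g$ is the set of $g$-tuples of $n\times n$ complex matrices, and $M(\mathbb{C})^g$ is the sequence $(M_n(\mathbb{C})^g)_{n\ge 1}$ (equivalently, the disjoint union over $n$). A subset $E\subset M(\mathbb{C})^g$ is a sequence $(E(n))_{n}$ with $E(n)\subset M_n(\mathbb{C})^g$; $X\in E$ means $X\in E(n)$ for some $n$; inclusions and unions are taken levelwise. The interior of $E(n)$ is taken in the usual Euclidean topology of $M_n(\mathbb{C})^g$. $E$ is closed with respect to direct sums if $X\in E(n)$ and $Y\in E(m)$ imply $X\oplus Y=\left(\begin{pmatrix}X_1&0\\0&Y_1\end{pmatrix},\dots,\begin{pmatrix}X_g&0\\0&Y_g\end{pmatrix}\right)\in E(n+m)$. A (scalar) free polynomial is an element $p=\sum_w p_w w$ (finite sum, $p_w\in\mathbb{C}$, $w$ words) of the free unital algebra over $\mathbb{C}$ on $g$ noncommuting variables $x_1,\dots,x_g$, evaluated at $X\in M_n(\mathbb{C})^g$ by $p(X)=\sum_w p_w w(X)$, where the empty word evaluates to $I_n$. A matrix-valued free polynomial is a matrix, of any finite size, whose entries are free polynomials; written $\delta=\sum_w \delta_w w$ with matrix coefficients $\delta_w$, it is evaluated by $\delta(X)=\sum_w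 \delta_w\otimes w(X)$. The norm $\|\cdot\|$ is the operator norm. The free topology on $M(\mathbb{C})^g$ has as a basis the sets $G_\delta=(G_\delta(n))_n$, $G_\delta(n)=\{X\in M_n(\mathbb{C})^g:\|\delta(X)\|<1\}$, where $\delta$ ranges over all matrix-valued free polynomials. Compact means every open cover has a finite subcover. *)

(* Defs.v *)
From HB Require Import structures.
From mathcomp Require Import all_boot all_order all_algebra.
From mathcomp Require Import finmap complex mxtens.
From mathcomp Require Import monalg.
From mathcomp Require Import all_classical all_reals all_analysis.

Set Implicit Arguments.
Unset Strict Implicit.
Unset Printing Implicit Defensive.

Import Order.TTheory GRing.Theory Num.Theory.
Import numFieldNormedType.Exports.
Import ComplexField.

Local Open Scope classical_set_scope.
Local Open Scope ring_scope.

Section OperatorNorm.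
Variable R : realType.

Definition l2norm n (v : 'cV[R[i]]_n) : R :=
  Num.sqrt (\sum_i Normc.normc (v i 0) ^+ 2).

Definition opnorm m n (A : 'M[R[i]]_(m, n)) : R :=
  sup [set l2norm (A *m v) | v in [set v : 'cV[R[i]]_n | l2norm v <= 1]].

End OperatorNorm.

(* The free unital algebra over C on x_0, ..., x_(g-1): the monoid algebra of
   the monoid {fmonom 'I_g} of words in the letters 'I_g. *)
Definition freepoly (R : realType) (g : nat) := {malg R[i][{fmonom 'I_g}]}.

Section Evaluation.
Variables (R : realType) (g n : nat).
Implicit Type X : 'I_g -> 'M[R[i]]_n.

Definition weval X (w : {fmonom 'I_g}) : 'M[R[i]]_n := \prod_(i <- w) X i.

Definition peval (p : freepoly R g) X : 'M[R[i]]_n :=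
  \sum_(w <- msupp p) p@_w *: weval X w.

Definition mxsupp k l (d : 'M[freepoly R g]_(k, l)) : {fset {fmonom 'I_g}} :=
  \big[fsetU/fset0]_(i < k) \big[fsetU/fset0]_(j < l) msupp (d i j).

(* [map_mx (mcoeff w) d] is the matrix coefficient d_w of the word w, and *t is
   the Kronecker product. *)
Definition mxpeval k l (d : 'M[freepoly R g]_(k, l)) X :
    'M[R[i]]_(k * n, l * n) :=
  \sum_(w <- mxsupp d) map_mx (mcoeff w) d *t weval X w.

End Evaluation.

(* The disjoint union over n >= 1 of the sets M_n(C)^g. *)
Record ncspace (R : realType) (g : nat) := NCPoint {
  nc_size : nat;
  nc_size_gt0 : (0 < nc_size)%N;
  nc_mx :> 'I_g -> 'M[R[i]]_nc_size }.

HB.instance Definition _ (R : realType) (g : nat) := gen_eqMixin (ncspace R g).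
HB.instance Definition _ (R : realType) (g : nat) :=
  gen_choiceMixin (ncspace R g).

Definition dsum_gt0 m n (m_gt0 : (0 < m)%N) : (0 < m + n)%N :=
  leq_trans m_gt0 (leq_addr n m).

Definition dsum (R : realType) (g : nat) (X Y : ncspace R g) : ncspace R g :=
  NCPoint (dsum_gt0 (nc_size Y) (nc_size_gt0 X))
    (fun i => block_mx (X i) 0 0 (Y i)).

Definition dsum_closed (R : realType) (g : nat) (E : set (ncspace R g)) :=
  forall X Y, E X -> E Y -> E (dsum X Y).

(* M_n(C)^g with its Euclidean topology. The cast is needed because the
   topology of C is attached to its numClosedFieldType structure. *)
Definition euclidean (R : realType) (g n : nat) : topologicalType :=
  {ptws 'I_g -> 'M[(R[i] : numClosedFieldType)]_n}.

(* The set E(n); it is empty for n = 0. *)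
Definition level (R : realType) (g : nat) (E : set (ncspace R g)) (n : nat) :
    set (euclidean R g n) :=
  [set X | exists n_gt0 : (0 < n)%N, E (NCPoint n_gt0 X)].
Arguments level {R g} E n.

Definition free_basic (R : realType) (g k l : nat)
    (d : 'M[freepoly R g]_(k, l)) : set (ncspace R g) :=
  [set X : ncspace R g | opnorm (mxpeval d X) < 1].

Definition free_basis (R : realType) (g : nat) : set (set (ncspace R g)) :=
  [set G | exists k l (d : 'M[freepoly R g]_(k, l)), G = free_basic d].

Section L2Theory.
Variable R : realType.
Local Notation C := R[i].
Local Notation normc := (@Normc.normc R).

Definition l2sq n (v : 'cV[C]_n) : R := \sum_i normc (v i 0) ^+ 2.

Lemma l2sq_ge0 n (v : 'cV[C]_n) : 0 <= l2sq v.
Proof. by apply: sumr_ge0 => i _; apply: sqr_ge0. Qed.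

Lemma normc_ge0 (x : C) : 0 <= normc x.
Proof. by case: x => a b /=; apply: sqrtr_ge0. Qed.

Lemma normc_sum (I : Type) (r : seq I) (F : I -> C) :
  normc (\sum_(i <- r) F i) <= \sum_(i <- r) normc (F i).
Proof.
elim/big_ind2: _ => [|x1 x2 y1 y2 h1 h2|//]; first by rewrite Normc.normc0.
by apply: le_trans (lerD h1 h2); apply: le_normcD.
Qed.

Lemma l2sqZ n (a : R) (v : 'cV[C]_n) : l2sq (a%:C%C *: v) = a ^+ 2 * l2sq v.
Proof.
rewrite /l2sq mulr_sumr; apply: eq_bigr => i _.
by rewrite mxE Normc.normcM exprMn /= expr0n /= addr0 sqr_sqrtr ?sqr_ge0.
Qed.

Lemma l2norm_le (n : nat) (v : 'cV[C]_n) (c : R) : 0 <= c ->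
  (l2norm v <= c) = (l2sq v <= c ^+ 2).
Proof.
move=> c0; rewrite -[in RHS](sqr_sqrtr (l2sq_ge0 v)) ler_pXn2r ?nnegrE ?sqrtr_ge0 //.
Qed.

Lemma l2sq0 n : l2sq (0 : 'cV[C]_n) = 0.
Proof.
by rewrite /l2sq big1 // => i _; rewrite mxE Normc.normc0 expr0n.
Qed.

Lemma opnorm_has_sup m n (A : 'M[C]_(m, n)) :
  has_sup [set l2norm (A *m v) | v in [set v : 'cV[C]_n | l2norm v <= 1]].
Proof.
split.
  exists (l2norm (A *m 0)); exists 0 => //=.
  by rewrite l2norm_le // l2sq0 expr1n.
exists (Num.sqrt (\sum_i (\sum_j normc (A i j)) ^+ 2)) => _ [v /= v1 <-].
rewrite ler_wsqrtr //; apply: ler_sum => i _.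
rewrite ler_pXn2r ?nnegrE ?normc_ge0 ?sumr_ge0 //; last first.
  by move=> j _; apply: normc_ge0.
rewrite mxE; apply: le_trans (normc_sum _ _) _.
apply: ler_sum => j _; rewrite Normc.normcM ler_piMr ?normc_ge0 //.
move: v1; rewrite l2norm_le // expr1n => v1.
rewrite -(@ler_pXn2r _ 2) ?nnegrE ?normc_ge0 // expr1n.
apply: le_trans v1; rewrite /l2sq (bigD1 j) //= lerDl.
by apply: sumr_ge0 => k _; apply: sqr_ge0.
Qed.

Lemma opnorm_ge0 m n (A : 'M[C]_(m, n)) : 0 <= opnorm A.
Proof.
apply: le_trans (_ : l2norm (A *m 0) <= _); first exact: sqrtr_ge0.
apply: sup_upper_bound; first exact: opnorm_has_sup.
by exists 0 => //=; rewrite l2norm_le // l2sq0 expr1n.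
Qed.

Lemma opnorm_bound m n (A : 'M[C]_(m, n)) v :
  l2sq (A *m v) <= opnorm A ^+ 2 * l2sq v.
Proof.
have [v0|v0] := eqVneq (l2sq v) 0.
  have -> : v = 0.
    apply/matrixP => i j; rewrite (ord1 j) mxE; apply: Normc.eq0_normc.
    have := v0; rewrite /l2sq; move/eqP.
    rewrite psumr_eq0 => [/allP/(_ i)|k _]; last exact: sqr_ge0.
    by rewrite mem_index_enum sqrf_eq0 => /(_ isT)/eqP.
  by rewrite mulmx0 !l2sq0 mulr0.
have vp : 0 < l2sq v by rewrite lt0r v0 l2sq_ge0.
pose a := (Num.sqrt (l2sq v))^-1.
have a2 : a ^+ 2 = (l2sq v)^-1 by rewrite exprVn sqr_sqrtr // ltW.
have : l2norm (A *m (a%:C%C *: v)) <= opnorm A.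
  apply: sup_upper_bound; first exact: opnorm_has_sup.
  by exists (a%:C%C *: v) => //=; rewrite l2norm_le // l2sqZ a2 mulVf // expr1n.
rewrite l2norm_le ?opnorm_ge0 // -scalemxAr l2sqZ a2 mulrC ler_pdivrMr //.
Qed.

Lemma opnorm_lt1 m n (A : 'M[C]_(m, n)) :
  opnorm A < 1 <->
  exists2 c : R, 0 <= c < 1 & forall v, l2sq (A *m v) <= c ^+ 2 * l2sq v.
Proof.
split=> [A1|[c /andP[c0 c1] Ac]].
  by exists (opnorm A) => [|v]; rewrite ?opnorm_ge0 ?A1 // opnorm_bound.
apply: le_lt_trans c1; apply: ge_sup; first by case: (opnorm_has_sup A).
move=> _ [v /= v1 <-]; rewrite l2norm_le //; apply: le_trans (Ac v) _.
by rewrite ler_piMr ?sqr_ge0 //; move: v1; rewrite l2norm_le // expr1n.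
Qed.

End L2Theory.

Section Basis.
Variables (R : realType) (g : nat).
Local Notation C := R[i].
Local Notation idx := mxtens_index.

Lemma mxpevalE n (X : 'I_g -> 'M[C]_n) k l (d : 'M[freepoly R g]_(k, l))
    i j a b :
  mxpeval d X (idx (i, a)) (idx (j, b)) = peval (d i j) X a b.
Proof.
rewrite /mxpeval /peval !summxE.
under eq_bigr do rewrite mxE !mxtens_indexK /= mxE.
under [RHS]eq_bigr do rewrite mxE.
apply/esym/big_fset_incl => [|w _].
  apply/fsubsetP => w wd; rewrite /mxsupp.
  rewrite (bigD1 i) //= inE (bigD1 j) //=.
  by rewrite inE wd.
by move/mcoeff_outdom => ->; rewrite mul0r.
Qed.

Lemma sum_idx (V : nmodType) k n (F : 'I_(k * n) -> V) :
  \sum_t F t = \sum_i \sum_a F (idx (i, a)).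
Proof.
rewrite pair_big /= (reindex (@idx k n)) /=; last first.
  by exists (@mxtens_unindex k n) => ? _; rewrite (mxtens_indexK, mxtens_unindexK).
by apply: eq_bigr => -[].
Qed.

Definition lpart l1 l2 n (v : 'cV[C]_((l1 + l2) * n)) : 'cV[C]_(l1 * n) :=
  \col_t v (idx (lshift l2 (mxtens_unindex t).1, (mxtens_unindex t).2)) 0.

Definition rpart l1 l2 n (v : 'cV[C]_((l1 + l2) * n)) : 'cV[C]_(l2 * n) :=
  \col_t v (idx (rshift l1 (mxtens_unindex t).1, (mxtens_unindex t).2)) 0.

Definition glue l1 l2 n (u : 'cV[C]_(l1 * n)) (v : 'cV[C]_(l2 * n)) :
    'cV[C]_((l1 + l2) * n) :=
  \col_t match fintype.split (mxtens_unindex t).1 with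
         | inl i => u (idx (i, (mxtens_unindex t).2)) 0
         | inr i => v (idx (i, (mxtens_unindex t).2)) 0
         end.

Lemma lpart_glue l1 l2 n (u : 'cV[C]_(l1 * n)) (v : 'cV[C]_(l2 * n)) :
  lpart (glue u v) = u.
Proof.
apply/matrixP => t z; rewrite (ord1 z); case: (mxtens_indexP t) => i a.
by rewrite !mxE !mxtens_indexK -[lshift _ _]/(unsplit (inl _)) unsplitK.
Qed.

Lemma rpart_glue l1 l2 n (u : 'cV[C]_(l1 * n)) (v : 'cV[C]_(l2 * n)) :
  rpart (glue u v) = v.
Proof.
apply/matrixP => t z; rewrite (ord1 z); case: (mxtens_indexP t) => i a.
by rewrite !mxE !mxtens_indexK -[rshift _ _]/(unsplit (inr _)) unsplitK.
Qed.

Lemma l2sq_parts l1 l2 n (v : 'cV[C]_((l1 + l2) * n)) :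
  l2sq v = l2sq (lpart v) + l2sq (rpart v).
Proof.
rewrite /l2sq !sum_idx big_split_ord /=.
by congr (_ + _); apply: eq_bigr => i _; apply: eq_bigr => a _;
  rewrite mxE mxtens_indexK.
Qed.

Lemma peval0 n (X : 'I_g -> 'M[C]_n) : peval 0 X = 0.
Proof. by rewrite /peval msupp0 big_seq_fset0. Qed.

Section Block.
Variables (k1 l1 k2 l2 n : nat) (X : 'I_g -> 'M[C]_n).
Variables (d1 : 'M[freepoly R g]_(k1, l1)) (d2 : 'M[freepoly R g]_(k2, l2)).
Variable v : 'cV[C]_((l1 + l2) * n).
Local Notation d := (block_mx d1 0 0 d2).

Lemma lpart_block : lpart (mxpeval d X *m v) = mxpeval d1 X *m lpart v.
Proof.
apply/matrixP => t z; rewrite (ord1 z).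
case: (mxtens_indexP t) => i a.
rewrite !mxE !sum_idx mxtens_indexK /= big_split_ord /= [X in _ + X]big1.
  rewrite addr0; apply: eq_bigr => j _; apply: eq_bigr => b _.
  by rewrite !mxpevalE block_mxEul mxE mxtens_indexK.
move=> j _; apply: big1 => b _.
by rewrite mxpevalE block_mxEur mxE peval0 mxE mul0r.
Qed.

Lemma rpart_block : rpart (mxpeval d X *m v) = mxpeval d2 X *m rpart v.
Proof.
apply/matrixP => t z; rewrite (ord1 z).
case: (mxtens_indexP t) => i a.
rewrite !mxE !sum_idx mxtens_indexK /= big_split_ord /= [X in X + _]big1.
  rewrite add0r; apply: eq_bigr => j _; apply: eq_bigr => b _.
  by rewrite !mxpevalE block_mxEdr mxE mxtens_indexK.
move=> j _; apply: big1 => b _.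
by rewrite mxpevalE block_mxEdl mxE peval0 mxE mul0r.
Qed.

End Block.

Lemma free_basicI k1 l1 k2 l2 (d1 : 'M[freepoly R g]_(k1, l1))
    (d2 : 'M[freepoly R g]_(k2, l2)) :
  free_basic (block_mx d1 0 0 d2) = free_basic d1 `&` free_basic d2.
Proof.
apply/seteqP; split=> X; rewrite /free_basic /=.
  move/opnorm_lt1 => [c c01 Xc].
  split; apply/opnorm_lt1; exists c => // v.
    have := Xc (glue v 0).
    rewrite l2sq_parts lpart_block rpart_block [in leRHS]l2sq_parts.
    by rewrite lpart_glue rpart_glue mulmx0 !l2sq0 !addr0.
  have := Xc (glue 0 v).
  rewrite l2sq_parts lpart_block rpart_block [in leRHS]l2sq_parts.
  by rewrite lpart_glue rpart_glue mulmx0 !l2sq0 !add0r.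
move=> [/opnorm_lt1[c1 /andP[c10 c11] X1] /opnorm_lt1[c2 /andP[c20 c21] X2]].
apply/opnorm_lt1; exists (Num.max c1 c2) => [|v].
  by rewrite le_max c10 gt_max c11 c21.
rewrite l2sq_parts lpart_block rpart_block [in leRHS]l2sq_parts mulrDr.
apply: lerD; [apply: le_trans (X1 _) _|apply: le_trans (X2 _) _].
  apply: ler_wpM2r; rewrite ?l2sq_ge0 //.
  by rewrite ler_pXn2r ?nnegrE ?le_max ?c10 ?lexx.
apply: ler_wpM2r; rewrite ?l2sq_ge0 //.
by rewrite ler_pXn2r ?nnegrE ?le_max ?c10 ?c20 ?lexx ?orbT.
Qed.

Lemma free_basis_cover : \bigcup_(G in @free_basis R g) id G = setT.
Proof.
apply/seteqP; split=> // X _.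
exists (free_basic (0 : 'M[freepoly R g]_1)) => [|/=].
  by exists 1%N, 1%N, 0.
apply/opnorm_lt1; exists 0 => [|v]; first by rewrite lexx ltr01.
suff -> : mxpeval (0 : 'M[freepoly R g]_1) X = 0.
  by rewrite mul0mx l2sq0 expr0n mul0r.
apply/matrixP => s t; case: (mxtens_indexP s) => i a.
by case: (mxtens_indexP t) => j b; rewrite mxpevalE !mxE peval0 mxE.
Qed.

Lemma free_basis_join (G H : set (ncspace R g)) (X : ncspace R g) :
  free_basis G -> free_basis H -> G X -> H X ->
  exists K, [/\ free_basis K, K X & K `<=` G `&` H].
Proof.
move=> [k1 [l1 [d1 ->]]] [k2 [l2 [d2 ->]]] X1 X2.
exists (free_basic (block_mx d1 0 0 d2)).
rewrite free_basicI; split=> //.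
by exists (k1 + k2)%N, (l1 + l2)%N, (block_mx d1 0 0 d2); rewrite free_basicI.
Qed.

End Basis.

(* The free topology: the sets [free_basic d] are a basis of it. *)
HB.instance Definition _ (R : realType) (g : nat) :=
  isBaseTopological.Build (ncspace R g)
    (@free_basis_cover R g) (@free_basis_join R g).

(* Main.v *)
(* For a point Y of E the characteristic polynomial q of its first coordinate
   gives a free polynomial q(x_0) that vanishes at Y. If every q(x_0) with q <> 0
   failed to vanish somewhere on E, it could be scaled so as to have norm at
   least 1 at some point of E; the basic open sets ||q(x_0)|| < 1 so obtained
   cover E, and the direct sum of the points attached to a finite subcover lies
   in E but in none of its members. Hence q(x_0) vanishes on E for a single
   q <> 0. If X were interior to E(n), then q(X_0 + t) = 0 for all small t, so q
   would vanish at a + t for an eigenvalue a of X_0 and all small t: thus N = 1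
   works. *)
Require Import Defs.
From mathcomp Require Import all_boot all_order all_algebra.
From mathcomp Require Import finmap complex mxtens monalg.
From mathcomp Require Import all_classical all_reals all_analysis.

Set Implicit Arguments.
Unset Strict Implicit.
Unset Printing Implicit Defensive.

Import Order.TTheory GRing.Theory Num.Theory.
Import numFieldNormedType.Exports.
Local Open Scope classical_set_scope.
Local Open Scope ring_scope.

(** A matrix neighbourhood contains a product of neighbourhoods of the finitely many entries, so the
    limit is checked entry by entry. *)
Lemma add_scalar_mx_cvg (K : numFieldType) n (A : 'M[K]_n) :
  A + t%:M @[t --> (0 : K)] --> A.
Proof.
move=> B [P AP PB]; rewrite nbhs_simpl /=.
suff : \forall t \near (0 : K), forall a b, P a b (A a b + t *+ (a == b)).
  apply: filterS => t tP; apply: PB => a b.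
  by have := tP a b; rewrite !mxE.
have F0 : Filter (nbhs (0 : K)) by exact: nbhs_filter.
apply: (filter_forall F0) => a; apply: (filter_forall F0) => b.
have : A a b + t *+ (a == b) @[t --> (0 : K)] --> A a b + 0 *+ (a == b).
  by apply: cvgD; [exact: cvg_cst|apply: cvgMn; exact: cvg_id].
by rewrite mul0rn addr0 => /(_ _ (AP a b)).
Qed.

Section FreePolynomials.
Variables (R : realType) (g : nat).
Local Notation C := R[i].
Implicit Types (p q : freepoly R g) (i : 'I_g).

(** * Linearity of evaluation *)

Lemma pevalEw n (X : 'I_g -> 'M[C]_n) p (D : {fset {fmonom 'I_g}}) :
  (msupp p `<=` D)%fset -> peval p X = \sum_(w <- D) p@_w *: weval X w.
Proof.
by move=> pD; apply: big_fset_incl => // w _ /mcoeff_outdom ->; rewrite scale0r.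
Qed.

Lemma pevalD n (X : 'I_g -> 'M[C]_n) :
  {morph (fun p => peval p X) : p q / p + q}.
Proof.
move=> p q; rewrite (pevalEw X (msuppD_le p q)).
rewrite (pevalEw X (fsubsetUl (msupp p) (msupp q))).
rewrite (pevalEw X (fsubsetUr (msupp p) (msupp q))) -big_split /=.
by apply: eq_bigr => w _; rewrite mcoeffD scalerDl.
Qed.

Lemma pevalZ n (X : 'I_g -> 'M[C]_n) (c : C) p :
  peval (c *: p) X = c *: peval p X.
Proof.
rewrite (pevalEw X (msuppZ_le c p)) scaler_sumr.
by apply: eq_bigr => w _; rewrite mcoeffZ scalerA.
Qed.

Lemma pevalU n (X : 'I_g -> 'M[C]_n) (c : C) (w : {fmonom 'I_g}) :
  peval (<< c *g w >> : freepoly R g) X = c *: weval X w.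
Proof. by rewrite (pevalEw X msuppU_le) big_seq_fset1 mcoeffUU. Qed.

(** * Polynomials in one letter *)

Definition letter_pow i k : {fmonom 'I_g} := FMonom (nseq k i).

Lemma letter_pow_inj i : injective (letter_pow i).
Proof. by move=> k l [] /(congr1 size); rewrite !size_nseq. Qed.

Definition letter_poly i (q : {poly C}) : freepoly R g :=
  \sum_(k < size q) << q`_k *g letter_pow i k >>.

(** Distinct powers of a letter are distinct words, so no cancellation occurs and the leading
    coefficient of [q] survives. *)
Lemma letter_poly_neq0 i (q : {poly C}) : q != 0 -> letter_poly i q <> 0.
Proof.
move=> q0 /(congr1 (mcoeff (letter_pow i (size q).-1))).
have sq : ((size q).-1 < size q)%N by rewrite ltn_predL size_poly_gt0.
rewrite mcoeff0 raddf_sum (bigD1 (Ordinal sq)) //= mcoeffUU big1.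
  by move/eqP; rewrite addr0 [_ == 0]lead_coef_eq0; apply/negP.
move=> k; rewrite -val_eqE /= => /negPf k_neq.
by rewrite mcoeffU (inj_eq (@letter_pow_inj i)) k_neq.
Qed.

Lemma peval_letter_poly n (X : 'I_g -> 'M[C]_n) i (q : {poly C}) :
  peval (letter_poly i q) X = \sum_(k < size q) q`_k *: X i ^+ k.
Proof.
rewrite /letter_poly (big_morph (fun p => peval p X) (pevalD X) (peval0 X)).
apply: eq_bigr => k _.
by rewrite pevalU /weval /= big_nseq iter_mulr_1.
Qed.

Lemma peval_letter_poly_char_poly n (X : 'I_g -> 'M[C]_n) i :
  (0 < n)%N -> peval (letter_poly i (char_poly (X i))) X = 0.
Proof.
case: n X => // n X _; rewrite peval_letter_poly -[RHS](Cayley_Hamilton (X i)).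
rewrite -[in RHS](coefK (char_poly (X i))) poly_def rmorph_sum /=.
by apply: eq_bigr => k _; rewrite horner_mxZ rmorphXn /= horner_mx_X.
Qed.

(** A left eigenvector of [X i] for [a] is scaled by [q.[a]] under [q] evaluated at [X i]. *)
Lemma root_peval_letter_poly n (X : 'I_g -> 'M[C]_n) i (q : {poly C}) (a : C) :
  peval (letter_poly i q) X = 0 -> eigenvalue (X i) a -> root q a.
Proof.
move=> qX0 /eigenvalueP[v vX v0].
have vXk k : v *m X i ^+ k = a ^+ k *: v.
  elim: k => [|k IHk]; first by rewrite mulmx1 scale1r.
  by rewrite exprSr mulmxA IHk -scalemxAl vX scalerA -exprSr.
have : v *m peval (letter_poly i q) X = q.[a] *: v.
  rewrite peval_letter_poly mulmx_sumr horner_coef scaler_suml.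
  by apply: eq_bigr => k _; rewrite -scalemxAr vXk scalerA.
by rewrite qX0 mulmx0 => /esym/eqP; rewrite scaler_eq0 (negPf v0) orbF.
Qed.

(** * Evaluation at direct sums *)

Lemma weval_dsum (X Y : ncspace R g) (w : {fmonom 'I_g}) :
  weval (dsum X Y) w = block_mx (weval X w) 0 0 (weval Y w).
Proof.
rewrite /weval; elim: (fmonom_val w) => [|i s IHs].
  by rewrite !big_nil -scalar_mx_block.
rewrite !big_cons IHs -mulmxE [LHS]mulmx_block.
by rewrite !mulmx0 !mul0mx !addr0 add0r.
Qed.

Lemma peval_dsum p (X Y : ncspace R g) :
  peval p (dsum X Y) = block_mx (peval p X) 0 0 (peval p Y).
Proof.
rewrite /peval; elim/big_rec3: _ => [|w A B D _ ->]; first by rewrite block_mx0.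
by rewrite weval_dsum scale_block_mx add_block_mx !scaler0 !addr0.
Qed.

(* Stands in for [||p(X)|| >= 1], and passes to direct sums entrywise. *)
Definition has_entry1 p (X : ncspace R g) := exists a b, peval p X a b = 1.

Lemma has_entry1_dsuml p (X Y : ncspace R g) :
  has_entry1 p X -> has_entry1 p (dsum X Y).
Proof.
move=> [a [b pab]]; exists (lshift _ a), (lshift _ b).
by rewrite peval_dsum block_mxEul.
Qed.

Lemma has_entry1_dsumr p (X Y : ncspace R g) :
  has_entry1 p Y -> has_entry1 p (dsum X Y).
Proof.
move=> [a [b pab]]; exists (rshift _ a), (rshift _ b).
by rewrite peval_dsum block_mxEdr.
Qed.

Lemma has_entry1_scale p (X : ncspace R g) :
  peval p X <> 0 -> exists c : C, has_entry1 (c *: p) X.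
Proof.
move=> /eqP/matrix0Pn[a [b pab]]; exists (peval p X a b)^-1.
by exists a, b; rewrite pevalZ mxE mulVf.
Qed.

(** * Basic open sets given by one polynomial *)

Definition free_ball p : set (ncspace R g) :=
  free_basic (p%:M : 'M[freepoly R g]_1).

Lemma free_ball_open p : open (free_ball p).
Proof.
exists [set free_ball p]; last by rewrite bigcup_set1.
by move=> _ ->; exists 1%N, 1%N, p%:M.
Qed.

Lemma free_ball_zero p (X : ncspace R g) : peval p X = 0 -> free_ball p X.
Proof.
move=> pX0; apply/opnorm_lt1; exists 0 => [|v]; first by rewrite lexx ltr01.
suff -> : mxpeval (p%:M : 'M[freepoly R g]_1) X = 0.
  by rewrite mul0mx l2sq0 expr0n mul0r.
apply/matrixP => s t; case: (mxtens_indexP s) => i a.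
case: (mxtens_indexP t) => j b.
by rewrite mxpevalE (ord1 i) (ord1 j) !mxE mulr1n pX0 mxE.
Qed.

Lemma l2sq_delta n (j : 'I_n) : l2sq (delta_mx j 0 : 'cV[C]_n) = 1.
Proof.
rewrite /l2sq (bigD1 j) //= mxE !eqxx Normc.normc1 expr1n.
rewrite big1 ?addr0 // => k kj.
by rewrite mxE (negPf kj) Normc.normc0 expr0n.
Qed.

(** The unit vector at the column of the entry 1 is sent to a vector of norm at least 1. *)
Lemma has_entry1_notin_free_ball p (X : ncspace R g) :
  has_entry1 p X -> ~ free_ball p X.
Proof.
move=> [a [b pab]] /opnorm_lt1[c /andP[c0 c1]].
move/(_ (delta_mx (mxtens_index (ord0, b)) 0)).
rewrite l2sq_delta mulr1 leNgt => /negP; apply.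
apply: (@lt_le_trans _ _ 1); first by rewrite expr_lt1.
rewrite /l2sq (bigD1 (mxtens_index (ord0, a))) //= -colE mxE mxpevalE.
rewrite mxE mulr1n pab Normc.normc1 expr1n lerDl.
by apply: sumr_ge0 => k _; apply: sqr_ge0.
Qed.

(** Induction on [s]: a witness for each new polynomial is added as a direct summand, which keeps
    the entries 1 already obtained. *)
Lemma common_has_entry1 (E : set (ncspace R g)) (s : seq (freepoly R g)) :
  dsum_closed E -> E !=set0 ->
  (forall p, p \in s -> exists2 X, E X & has_entry1 p X) ->
  exists2 X, E X & forall p, p \in s -> has_entry1 p X.
Proof.
move=> E_dsum [X0 EX0]; elim: s => [|p s IHs] hs; first by exists X0.
have [|X EX sX] := IHs; first by move=> q qs; apply: hs; rewrite inE qs orbT.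
have [|Y EY pY] := hs p; first by rewrite inE eqxx.
exists (dsum X Y) => [|q]; first exact: E_dsum.
rewrite inE => /orP[/eqP ->|qs]; first exact: has_entry1_dsumr.
by apply: has_entry1_dsuml; apply: sX.
Qed.

(** * The compactness argument *)

Lemma compact_vanishing (E : set (ncspace R g)) (F : set (freepoly R g)) :
  dsum_closed E -> cover_compact E -> E !=set0 ->
  (forall Y, E Y -> exists2 p, F p & peval p Y = 0) ->
  exists2 p, F p & forall Y, E Y -> peval p Y = 0.
Proof.
move=> E_dsum E_compact E0 EF; apply: contrapT => noF.
have {}noF p : F p -> exists2 X, E X & peval p X <> 0.
  move=> Fp; apply: contrapT => noX; apply: noF; exists p => // Y EY.
  by apply: contrapT => pY; apply: noX; exists Y.
(* The cover is indexed by [D] rather than [F], since [F] need not contain the scaled polynomials;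
   each set of the cover misses a point of [E]. *)
pose D := [set p | exists2 X, E X & has_entry1 p X].
have [||s sD sE] := E_compact _ D free_ball.
- by move=> p _; apply: free_ball_open.
- move=> Y /EF[p Fp pY]; have [X EX pX] := noF p Fp.
  have [c cpX] := has_entry1_scale pX.
  exists (c *: p); first by exists X.
  by apply: free_ball_zero; rewrite pevalZ pY scaler0.
(* Since [E] is nonempty, such a point exists even for an empty subcover. *)
have [|X EX sX] := @common_has_entry1 E s E_dsum E0.
  by move=> p /sD; rewrite inE.
by have [p /= ps] := sE X EX; apply: has_entry1_notin_free_ball; apply: sX.
Qed.

(** * Interior points and scalar shifts *)

Lemma near_shift_level (E : set (ncspace R g)) n (X : euclidean R g n) :
  interior (level E n) X ->
  \forall t \near (0 : (C : numClosedFieldType)),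
    level E n (fun i => X i + t%:M).
Proof.
pose shift (t : (C : numClosedFieldType)) : euclidean R g n :=
  fun i => X i + t%:M.
have shift_filter : Filter (shift @ 0).
  exact: (@fmap_filter _ _ _ _ (nbhs_filter (0 : (C : numClosedFieldType)))).
have shift_cvg : shift @ 0 --> X.
  (* The product topology is the supremum of those pulled back from the coordinates, so each
     coordinate is treated alone. *)
  apply/cvg_sup => i A [_ [[B oB <-] BX] BA].
  have /add_scalar_mx_cvg XB : nbhs (X i) B by apply: open_nbhs_nbhs.
  by apply: (@filterS _ (shift @ 0) shift_filter _ _ BA); exact: XB.
by move=> intX; apply: shift_cvg intX.
Qed.

End FreePolynomials.

Lemma near_root_eq0 (K : numFieldType) (q : {poly K}) (a : K) :
  (\forall t \near (0 : K), root q (a + t)) -> q = 0.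
Proof.
move=> /nbhs_ballP[e /= e0 qe]; apply/eqP/negP => /negP q0.
(* These are [size q] distinct roots, one more than the degree allows; the offset 2 keeps
   [e / k.+2%:R] strictly below [e]. *)
pose rs := [seq a + e / k.+2%:R | k <- iota 0 (size q)].
have : (size rs < size q)%N.
  apply: max_poly_roots => //.
    apply/allP => _ /mapP[k _ ->]; apply: qe.
    rewrite /ball /= sub0r normrN normrM normfV normr_nat gtr0_norm //.
    by rewrite ltr_pdivrMr ?ltr0n // ltr_pMr // ltr1n.
  rewrite map_inj_uniq ?iota_uniq // => k l /addrI /(mulfI (lt0r_neq0 e0)).
  by move/invr_inj/eqP; rewrite eqr_nat => /eqP[].
by rewrite size_map size_iota ltnn.
Qed.

Theorem corollary1p2 (R : realType) (g : nat) (g_gt0 : (0 < g)%N)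
    (E : set (ncspace R g)) (E_dsum : dsum_closed E)
    (E_compact : cover_compact E) :
  (exists p : freepoly R g,
     p <> 0 /\ forall Y : ncspace R g, E Y -> peval p Y = 0) /\
  (exists N : nat, (0 < N)%N /\
     forall n : nat, (N <= n)%N -> interior (level E n) = set0).
Proof.
pose i0 : 'I_g := Ordinal g_gt0.
(* Restricting to one letter makes the common annihilator univariate, as the eigenvalue argument
   requires. *)
pose F := [set p : freepoly R g | exists2 q, q != 0 & p = letter_poly i0 q].
have [p [q q0 ->] qE] : exists2 p, F p & forall Y, E Y -> peval p Y = 0.
  (* On the empty set any nonzero polynomial will do, here the constant 1. *)
  have [->|E0] := eqVneq E set0.
    by exists (letter_poly i0 1) => //; exists 1; rewrite ?oner_neq0.
  apply: compact_vanishing => //; first exact/set0P.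
  move=> Y EY; exists (letter_poly i0 (char_poly (Y i0))).
    by exists (char_poly (Y i0)); rewrite ?monic_neq0 ?char_poly_monic.
  exact: peval_letter_poly_char_poly (nc_size_gt0 Y).
split; first by exists (letter_poly i0 q); split=> //; exact: letter_poly_neq0.
exists 1%N; split=> // n n_gt0; apply/seteqP; split=> // X /near_shift_level XE.
have [a Xa] := eigenvalue_closed (X i0) n_gt0.
suff /near_root_eq0 q_eq0 : \forall t \near (0 : (R[i] : numClosedFieldType)),
    root q (a + t) by rewrite q_eq0 eqxx in q0.
apply: filterS XE => t [n_gt0' EXt].
apply: (root_peval_letter_poly (qE _ EXt)) => /=.
(* An eigenvector of [X i0] for [a] is one of the shifted matrix for [a + t]. *)
have /eigenvalueP[v vX v0] := Xa.
apply/eigenvalueP; exists v => //.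
by rewrite mulmxDr vX mul_mx_scalar scalerDl.
Qed.
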